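(* Let $\mathbb{X}$ be a finite dimensional real inner product space, $\mathcal{K}\subseteq\mathbb{X}$ a nonempty closed convex cone, $Q\colon\mathbb{X}\to\mathbb{X}$ a linear operator and $q\in\mathbb{X}$. Consider the projection equation $$(Q-\mathrm{Id})P_{\mathcal{K}}(x)+x=-q \qquad (\mathrm{E})$$ and the KKT system $$\langle Q\overline{x}+q,\overline{x}\rangle=0,\qquad Q\overline{x}+q\in\mathcal{K}^*,\qquad \overline{x}\in\mathcal{K}. \qquad (\mathrm{KKT})$$ If $x$ is a solution of (E), then $\overline{x}=P_{\mathcal{K}}(x)$ is a solution of (KKT). Conversely, if $\overline{x}$ is a solution of (KKT), then $x=\overline{x}-(Q\overline{x}+q)$ is a solution of (E).
   Context: $\mathrm{Id}$ is the identity operator, $\|x\|=\sqrt{\langle x,x\rangle}$, $P_{\mathcal{K}}(x)=\operatorname{argmin}\{\|y-x\| : y\in\mathcal{K}\}$ is the projection onto $\mathcal{K}$, and $\mathcal{K}^*=\{y\in\mathbb{X} : \langle y,x\rangle\ge 0\ \ \forall x\in\mathcal{K}\}$ is the dual cone. The system (KKT) is the system of complementary KKT conditions of the quadratic conic program $\min\ \frac12\langle x,Qx\rangle+\langle q,x\rangle$ subject to $x\in\mathcal{K}$. *)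

(* Defs.v *)
From HB Require Import structures.
From mathcomp Require Import all_boot all_order all_algebra.
From mathcomp Require Import all_classical all_reals all_analysis.
From mathcomp Require Import ring lra.

Set Implicit Arguments.
Unset Strict Implicit.
Unset Printing Implicit Defensive.

Import Order.TTheory GRing.Theory Num.Theory.
Import numFieldNormedType.Exports.

Local Open Scope classical_set_scope.
Local Open Scope ring_scope.

(* A finite dimensional real inner product space is a [V : vectType R] with a
   symmetric positive definite bilinear form [ip : {dot V for idfun}].  The
   alias [dotspace ip] of [V] is the normed space whose norm is
   [Num.sqrt (ip x x)], so that [`|x|] and [closed] refer to the norm and the
   topology induced by [ip]. *)
Definition dotspace (R : realType) (V : vectType R)
  (ip : {dot V for @idfun R}) : Type := V.

Section dotspace_normed.
Variables (R : realType) (V : vectType R) (ip : {dot V for @idfun R}).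

HB.instance Definition _ := Vector.on (dotspace ip).

Lemma ipC (x y : V) : ip x y = ip y x.
Proof. by rewrite hermC expr0 mul1r. Qed.

Lemma ip_ge0 (x : V) : 0 <= ip x x.
Proof.
have [->|x0] := eqVneq x 0; first by rewrite linear0r.
exact/ltW/neq0_dnorm_gt0.
Qed.

Lemma ip_eq0 (x : V) : ip x x = 0 -> x = 0.
Proof.
have [//|x0] := eqVneq x 0 => e.
by have : 0 < ip x x := neq0_dnorm_gt0 x x0; rewrite e ltxx.
Qed.

Definition ip_norm (x : V) : R := Num.sqrt (ip x x).

Lemma ip_normD (x y : V) : ip_norm (x + y) <= ip_norm x + ip_norm y.
Proof.
pose n := ip_norm.
have n2 u : n u ^+ 2 = ip u u by rewrite sqr_sqrtr// ip_ge0.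
have n0 u : 0 <= n u by exact: sqrtr_ge0.
have CS : ip x y <= n x * n y.
  have [x0|x0] := eqVneq (n x) 0.
    have -> : x = 0 by apply: ip_eq0; rewrite -n2 x0 expr0n.
    by rewrite linear0l mulr_ge0.
  have [y0|y0] := eqVneq (n y) 0.
    have -> : y = 0 by apply: ip_eq0; rewrite -n2 y0 expr0n.
    by rewrite linear0r mulr_ge0.
  have := ip_ge0 (n y *: x - n x *: y).
  rewrite hnormB expr0 mul1r /= !(linearZl_LR, linearZr_LR) /= -!n2.
  have -> : n y * (n y * n x ^+ 2) + n x * (n x * n y ^+ 2)
    - (n x * (n y * ip x y) + n x * (n y * ip x y)) =
    (n x * n y) * (n x * n y - ip x y) *+ 2.
    by rewrite -[RHS]mulr_natr; ring.
  rewrite pmulrn_lge0// pmulr_rge0 ?subr_ge0// mulr_gt0// lt_def.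
    by rewrite x0 n0.
  by rewrite y0 n0.
rewrite -(@ler_pXn2r _ 2)// ?nnegrE ?addr_ge0 ?n0//.
rewrite -/n n2 hnormD expr0 mul1r /= -!n2 sqrrD.
have -> : n x ^+ 2 + n y ^+ 2 + (ip x y + ip x y) =
          n x ^+ 2 + (ip x y) *+ 2 + n y ^+ 2 by rewrite mulr2n addrAC.
by rewrite lerD2r lerD2l lerMn2r CS orbT.
Qed.

Lemma ip_normZ (a : R) (x : V) : ip_norm (a *: x) = `|a| * ip_norm x.
Proof.
rewrite /ip_norm linearZl_LR linearZr_LR /= mulrA -expr2.
by rewrite sqrtrM ?sqr_ge0// sqrtr_sqr.
Qed.

Lemma ip_norm_eq0 (x : V) : ip_norm x = 0 -> x = 0.
Proof.
move=> /eqP; rewrite sqrtr_eq0 => h; apply: ip_eq0.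
by apply/eqP; rewrite eq_le h ip_ge0.
Qed.

HB.instance Definition _ :=
  Lmodule_isNormed.Build R (dotspace ip) ip_normD ip_normZ ip_norm_eq0.

Lemma dotspace_normE (x : dotspace ip) : `|x| = Num.sqrt (ip x x).
Proof. by []. Qed.

End dotspace_normed.

Section conic.
Variables (R : realType) (V : vectType R) (ip : {dot V for @idfun R}).
Local Notation X := (dotspace ip).

(* Vertex at the origin; only positive multiples are required, so [K 0] is not
   part of the definition (it follows when [K] is nonempty and closed). *)
Definition is_cone (K : set X) : Prop :=
  forall (t : R) (x : X), 0 < t -> K x -> K (t *: x).

Definition dual_cone (K : set X) : set X :=
  [set y | forall x, K x -> 0 <= ip y x].

Definition nearest_points (K : set X) (x : X) : set X :=
  [set p | K p /\ forall y, K y -> `|p - x| <= `|y - x|].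

(* The default value [0] of [xget] is used only where [nearest_points K x] is empty,
   which does not happen for a nonempty closed convex [K]. *)
Definition cone_proj (K : set X) (x : X) : X := xget 0 (nearest_points K x).

Definition proj_eq (Q : {linear X -> X}) (q : X) (K : set X) (x : X) : Prop :=
  (Q \- idfun) (cone_proj K x) + x = - q.

Definition kkt (Q : {linear X -> X}) (q : X) (K : set X) (xb : X) : Prop :=
  [/\ ip (Q xb + q) xb = 0, dual_cone K (Q xb + q) & K xb].

End conic.

(* Main.v *)
(* A nearest point [p] of [K] to [x] is characterised by Moreau's conditions: [p]
   is in [K], [p - x] is in the dual cone, and [p - x] is orthogonal to [p].
   Under (E) one has [p - x = Q p + q], which turns them into (KKT); conversely
   [x = xb - (Q xb + q)] gives [xb - x = Q xb + q], so (KKT) says that [xb] is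
   the projection of [x].  Closed bounded sets are compact in finite dimension,
   hence the nearest point exists. *)
Require Import Defs.
From HB Require Import structures.
From mathcomp Require Import all_boot all_order all_algebra.
From mathcomp Require Import all_classical all_reals all_analysis.
From mathcomp Require Import ring lra.

Set Implicit Arguments.
Unset Strict Implicit.
Unset Printing Implicit Defensive.

Import Order.TTheory GRing.Theory Num.Theory.
Import numFieldNormedType.Exports.

Local Open Scope classical_set_scope.
Local Open Scope ring_scope.

Lemma le_bounded_set (R : numFieldType) (W : pseudoMetricNormedZmodType R)
    (A : set W) (M : R) :
  M \is Num.real -> (forall x, A x -> `|x| <= M) -> bounded_set A.
Proof.
move=> MR AM; exists M; split => // N MN x /AM xM.
exact: le_trans xM (ltW MN).
Qed.

Section dotspace_theory.
Variables (R : realType) (V : vectType R) (ip : {dot V for @idfun R}).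
Local Notation X := (dotspace ip).

Lemma dotspace_normX2 (x : X) : `|x| ^+ 2 = ip x x.
Proof. by rewrite dotspace_normE sqr_sqrtr// ip_ge0. Qed.

Lemma dotspace_normD2 (x y : X) :
  `|x + y| ^+ 2 = `|x| ^+ 2 + ip x y *+ 2 + `|y| ^+ 2.
Proof.
rewrite !dotspace_normX2 linearDl !linearDr /= (ipC ip y x) mulr2n.
by rewrite !addrA.
Qed.

(** Cauchy-Schwarz, read off from the square of the triangle inequality. *)
Lemma ip_le_norm (x y : X) : ip x y <= `|x| * `|y|.
Proof.
have : `|x + y| ^+ 2 <= (`|x| + `|y|) ^+ 2.
  by rewrite ler_pXn2r ?nnegrE ?addr_ge0// ler_normD.
by rewrite dotspace_normD2 sqrrD lerD2r lerD2l lerMn2r.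
Qed.

Lemma normr_ip_le (x y : X) : `|ip x y| <= `|x| * `|y|.
Proof.
rewrite ler_norml ip_le_norm andbT lerNl -(normrN x).
by apply: le_trans (ip_le_norm (- x) y); rewrite linearNl.
Qed.

(* The coordinates of [x] are replaced by its inner products with a basis:
   these are bounded by the norm of [x] without any equivalence of norms. *)
Definition ip_row (x : X) : 'rV[R]_(\dim {:V}) :=
  \row_i ip x (vbasis {:V})`_i.

Fact ip_row_is_linear : linear ip_row.
Proof.
by move=> a x y; apply/rowP => i; rewrite !mxE linearDl linearZl_LR.
Qed.

HB.instance Definition _ :=
  GRing.isLinear.Build R X _ _ ip_row ip_row_is_linear.

(** If the rows agree, [x - y] is orthogonal to a basis, hence to itself. *)
Lemma ip_row_inj : injective ip_row.
Proof.
move=> x y /eqP; rewrite -subr_eq0 -linearB => /eqP /rowP xy0.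
apply/subr0_eq/(@ip_eq0 _ _ ip).
rewrite {2}(coord_vbasis (memvf (x - y : V))) linear_sumr big1//= => i _.
by have := xy0 i; rewrite !mxE linearZr_LR /= => ->; rewrite mulr0.
Qed.

(** An injective linear map between spaces of equal dimension is onto. *)
Lemma ip_row_sur (v : 'rV[R]_(\dim {:V})) : exists x, ip_row x = v.
Proof.
pose f : 'Hom(X, 'rV[R]_(\dim {:V})) := linfun ip_row.
have fE : f =1 ip_row by exact: lfunE.
have /eqP kf : lker f == 0%VS.
  by apply/lker0P => x y; rewrite !fE; exact: ip_row_inj.
have /memv_imgP[x _ ->] : v \in limg f.
  suff -> : limg f = fullv by rewrite memvf.
  apply/eqP; rewrite eqEdim subvf limg_dim_eq ?kf ?capv0//.
  by rewrite !dimvf /dim /= mul1n -/(dim _).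
by exists x.
Qed.

Lemma continuous_rV_linear n (g : {linear 'rV[R]_n -> X}) : continuous g.
Proof.
apply/linear_bounded_continuous/bounded_funP => r.
exists (`|r| * \sum_i `|g (delta_mx 0 i)|) => v vr.
rewrite (row_sum_delta v) linear_sum mulr_sumr.
apply: le_trans (ler_norm_sum _ _ _) _; apply: ler_sum => i _.
rewrite linearZ normrZ ler_wpM2r//.
apply: le_trans (ler_norm r); apply: le_trans vr.
by rewrite [leRHS]/Num.norm/= mx_normrE; apply/bigmax_geP; right; exists (0, i).
Qed.

(** Heine-Borel is transported from row vectors: [A] is the image of a closed bounded set under the
    continuous linear inverse [g] of [ip_row]. *)
Lemma dotspace_bounded_closed_compact (A : set X) :
  bounded_set A -> closed A -> compact A.
Proof.
move=> [M [_ AM]] A_closed.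
have [g gK] := choice ip_row_sur.
have Kg : cancel ip_row g by move=> x; apply: ip_row_inj; rewrite gK.
have g_lin : linear g.
  by move=> a u v; apply: ip_row_inj; rewrite gK linearP /= !gK.
pose G := HB.pack_for {linear _ -> X} g (GRing.isLinear.Build R _ X _ g g_lin).
have g_cont : continuous g by exact: (@continuous_rV_linear _ G).
have -> : A = g @` (g @^-1` A).
  apply/seteqP; split => [x Ax|_ [v Av <-]//].
  by exists (ip_row x); rewrite /= Kg.
apply: continuous_compact; first exact: continuous_subspaceT.
apply: bounded_closed_compact; last first.
  by apply: preimage_closed => // v _; exact: g_cont.
(* By Cauchy-Schwarz each entry of [ip_row x] is at most [|x|] times the norm of a basis vector.
   Boundedness only provides bounds strictly above [M], hence [M + 1]. *)
apply: (@le_bounded_set _ _ _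
  ((M + 1) * \sum_(i < \dim {:V}) `|(vbasis {:V})`_i : X|)).
  exact: num_real.
move=> v Agv.
have {}Agv : `|g v| <= M + 1 by apply: AM Agv; rewrite ltrDl.
have M1_ge0 := le_trans (normr_ge0 _) Agv.
rewrite [leLHS]/Num.norm/= mx_normrE; apply/bigmax_leP; split => /=.
  by rewrite mulr_ge0// sumr_ge0.
move=> [i j] _ /=; rewrite (ord1 i) -(gK v) mxE.
apply: le_trans (normr_ip_le _ _) _; rewrite ler_pM//.
by rewrite (bigD1 j)//= lerDl sumr_ge0.
Qed.

Lemma nearest_points_neq0 (K : set X) (x : X) :
  K !=set0 -> closed K -> nearest_points K x !=set0.
Proof.
move=> [y0 Ky0] K_closed; pose d (y : X) := `|y - x|.
have d_cont : continuous d.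
  move=> y; apply: (@continuous_comp X X R (fun y => y - x) Num.norm);
    last exact: norm_continuous.
  apply: continuousB; [exact: cvg_id|apply: cvg_cst; exact: (nbhs_filter y)].
(* Points of [K] farther from [x] than [y0] cannot beat [y0], so it suffices to minimise over this
   compact slice. *)
pose A := K `&` d @^-1` [set t | t <= d y0].
have A_compact : compact A.
  apply: dotspace_bounded_closed_compact.
    apply: (@le_bounded_set _ _ _ (d y0 + `|x|)); first exact: num_real.
    move=> y [_ yd].
    by rewrite -[y](subrK x) (le_trans (ler_normD _ _))// lerD2r.
  by apply: closedI => //; apply: preimage_closed => //; exact: closed_le.
have [||p /[!inE] -[Kp pd] pmin] := @compact_EVT_min _ _ d A _ A_compact.
- by exists y0; split => //=.
- exact: continuous_subspaceT.
exists p; split => // y Ky; have [yd|/ltW yd] := leP (d y) (d y0).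
  by apply: pmin; rewrite inE.
exact: le_trans pd yd.
Qed.

Lemma cone_proj_nearest (K : set X) (x : X) :
  K !=set0 -> closed K -> nearest_points K x (cone_proj K x).
Proof.
by move=> K0 Kc; have [p px] := nearest_points_neq0 x K0 Kc; exact: xgetI px.
Qed.

(** The sum is twice the midpoint. *)
Lemma convex_coneD (K : set X) (x y : X) :
  convex_set K -> is_cone K -> K x -> K y -> K (x + y).
Proof.
move=> K_convex K_cone Kx Ky.
have half_ge0 : 0 <= 2^-1 :> R by rewrite invr_ge0.
have half_le1 : 2^-1 <= 1 :> R by rewrite invf_le1 ?ler1n.
have := K_convex x y (Itv01 half_ge0 half_le1).
rewrite !inE => /(_ Kx Ky) /(K_cone 2 _ (ltr0n _ _)).
congr K; rewrite /conv /= scalerDr !scalerA.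
have -> : 2 * (1 - 2^-1) = 1 :> R by field.
by rewrite mulfV// !scale1r.
Qed.

(* First-order optimality: [t |-> `|p + t v - x| ^+ 2] cannot have a negative
   slope at [t = 0] when [p + t v] is feasible for small [t > 0]. *)
Lemma nearest_point_ip_ge0 (K : set X) (x p v : X) :
  nearest_points K x p -> (forall t : R, 0 < t < 1 -> K (p + t *: v)) ->
  0 <= ip (p - x) v.
Proof.
move=> [_ pmin] Kpv; rewrite leNgt; apply/negP => s_lt0.
set s := ip (p - x) v in s_lt0.
have key t : 0 < t < 1 -> 0 <= s *+ 2 + t * `|v| ^+ 2.
  move=> t01; have /andP[t0 _] := t01; have := pmin _ (Kpv t t01).
  rewrite -(@ler_pXn2r _ 2)// ?nnegrE// addrAC (dotspace_normD2 (p - x)).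
  rewrite -addrA lerDl linearZr_LR /= -/s normrZ gtr0_norm// exprMn => h.
  by rewrite -(pmulr_rge0 _ t0) mulrDr mulrnAr mulrA -expr2.
(* The denominator exceeds both [- s] and [|v| ^+ 2]. Thus [t < 1], and [t * |v| ^+ 2 < - s] makes
   the expression in [key] smaller than [s], hence negative. *)
pose t := - s / (- s + `|v| ^+ 2 + 1).
have D0 : 0 < - s + `|v| ^+ 2 + 1 by have := sqr_ge0 `|v|; lra.
have t0 : 0 < t by rewrite divr_gt0// oppr_gt0.
have t1 : t < 1 by rewrite ltr_pdivrMr//; have := sqr_ge0 `|v|; lra.
have tE : t * (- s + `|v| ^+ 2 + 1) = - s by rewrite divfK// gt_eqF.
have := key t; rewrite t0 t1 => /(_ isT).
have := sqr_ge0 `|v|; nra.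
Qed.

End dotspace_theory.

Theorem theorem4p1 (R : realType) (V : vectType R) (ip : {dot V for @idfun R})
    (K : set (dotspace ip)) (Q : {linear dotspace ip -> dotspace ip})
    (q : dotspace ip)
    (K_neq0 : K !=set0) (K_closed : closed K) (K_convex : convex_set K)
    (K_cone : is_cone K) :
  (forall x : dotspace ip, proj_eq Q q K x -> kkt Q q K (cone_proj K x)) /\
  (forall xb : dotspace ip, kkt Q q K xb -> proj_eq Q q K (xb - (Q xb + q))).
Proof.
split=> [x|xb [ipxb dual Kxb]].
  have := cone_proj_nearest x K_neq0 K_closed; set p := cone_proj K x.
  move=> px; have [Kp _] := px; rewrite /proj_eq -/p /= => pE.
  have gE : Q p + q = p - x.
    by rewrite -[q]opprK -pE !opprD opprK !addrA subrr add0r.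
  rewrite /kkt gE; split => //.
    apply/eqP; rewrite eq_le; apply/andP; split.
      (* Orthogonality comes from the two directions [- p] and [p]: the ray through [p] stays in [K]
         both ways, as [p - t p = (1 - t) p] with [t < 1]. *)
      rewrite -oppr_ge0 -linearNr.
      apply: (nearest_point_ip_ge0 px) => t /andP[_ t1].
      rewrite scalerN -[X in X - _]scale1r -scalerBl.
      by apply: K_cone => //; rewrite subr_gt0.
    apply: (nearest_point_ip_ge0 px) => t /andP[t0 _].
    by apply: convex_coneD => //; exact: K_cone.
  move=> y Ky; apply: (nearest_point_ip_ge0 px) => t /andP[t0 _].
  by apply: convex_coneD => //; exact: K_cone.
set g := Q xb + q in ipxb dual *; set x := xb - g.
have xbx : xb - x = g by rewrite opprB addrC subrK.
(* Pythagorean inequality: the cross term is [ip g (y - xb) = ip g y], nonnegative by dual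
   feasibility. *)
have far y : K y -> `|xb - x| ^+ 2 + `|y - xb| ^+ 2 <= `|y - x| ^+ 2.
  move=> Ky; have -> : y - x = (xb - x) + (y - xb).
    by rewrite [RHS]addrC addrA subrK.
  rewrite (dotspace_normD2 (xb - x)) lerD2r lerDl xbx linearBr /= ipxb subr0.
  by rewrite mulrn_wge0//; exact: dual.
have [Kp /(_ _ Kxb) pmin] := cone_proj_nearest x K_neq0 K_closed.
(* The chosen nearest point is no farther from [x] than [xb], so [far] leaves no room for a nonzero
   distance to [xb]; this also settles uniqueness. *)
have pE : cone_proj K x = xb.
  apply/subr0_eq/normr0_eq0/eqP; rewrite -sqrf_eq0 eq_le sqr_ge0 andbT.
  rewrite -(lerD2l (`|xb - x| ^+ 2)) addr0; apply: le_trans (far _ Kp) _.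
  by rewrite ler_pXn2r ?nnegrE.
by rewrite /proj_eq pE /= /x /g addrA subrK opprD addrA subrr add0r.
Qed.
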